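(* Let $n\ge 3$, $k\ge 3$. For each $\alpha=a_1\cdots a_n\in\mathbf{A}_k(n)\setminus\{r_{n,k}\}$ let $p(\alpha)$ be the position modified by the parent rule, namely $p(\alpha)=j$ if $\mathrm{Par}(\alpha)=\mathrm{LastNonMax}(\alpha)$, $p(\alpha)=n$ if $\mathrm{Par}(\alpha)$ is obtained via $\mathrm{LastSymbol}$, $p(\alpha)=i$ if obtained via $\mathrm{FirstNonMin}$, and $p(\alpha)=\ell$ if obtained via $\mathrm{SecondLastNonMax}$ (with $i,j,\ell$ as defined below, and the case determined by the first operation in the list that yields an element of $\mathbf{A}_k(n)$). Let $s(\alpha)=a_{p+1}\cdots a_na_1\cdots a_{p-1}$ (length $n-1$) where $p=p(\alpha)$; thus $\alpha$ and $\mathrm{Par}(\alpha)$ are joined via the conjugate pair $(a_p s(\alpha),\, y\, s(\alpha))$ with $y\ne a_p$ and $y s(\alpha)\in[\mathrm{Par}(\alpha)]$. Then the tree induced by $\mathrm{Par}$ has the Chain Property: if $\alpha\neq\alpha'$ are elements of $\mathbf{A}_k(n)\setminus\{r_{n,k}\}$ with $\mathrm{Par}(\alpha)=\mathrm{Par}(\alpha')$, then $s(\alpha)\neq s(\alpha')$.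
   Context: Let $\Sigma=\{0,1,\dots,k-1\}$. Strings are compared lexicographically ($\alpha<\beta$ if $\alpha$ is a proper prefix of $\beta$, or $\alpha$ has the smaller symbol at the first index where they differ). For $\alpha=a_1\cdots a_n$, $\alpha^R=a_n\cdots a_1$; $[\alpha]$ is the set of rotations of $\alpha$. $\alpha$ is a necklace if it is the lexicographically smallest element of $[\alpha]$; a bracelet if it is the lexicographically smallest element of $[\alpha]\cup[\alpha^R]$. A necklace $\alpha$ is symmetric if $\alpha^R\in[\alpha]$, asymmetric otherwise. $\mathbf{A}_k(n)$ is the set of asymmetric bracelets of length $n$ over $\Sigma$. $r_{n,k}=0^{n-2}(k-2)(k-1)$. Operations on $\alpha=a_1\cdots a_n$: $\mathrm{LastNonMax}(\alpha)=a_1\cdots a_{j-1}(a_j+1)(k-1)^{n-j}$, where $j$ is the index of the last symbol different from $k-1$; $\mathrm{LastSymbol}(\alpha)$ is the necklace (smallest rotation) of $a_1\cdots a_{n-1}((a_n+1)\bmod k)$; $\mathrm{FirstNonMin}(\alpha)=0^{i-1}(a_i-1)a_{i+1}\cdots a_n$, where $i$ is the index of the first nonzero symbol; $\mathrm{SecondLastNonMax}(\alpha)=a_1\cdots a_{\ell-1}(a_\ell+1)a_{\ell+1}\cdots a_n$, where $\ell$ is the index of the second-last symbol different from $k-1$. Parent rule: for $\alpha\in\mathbf{A}_k(n)\setminus\{r_{n,k}\}$, $\mathrm{Par}(\alpha)$ is the first string in the list $\langle \mathrm{LastNonMax}(\alpha),\mathrm{LastSymbol}(\alpha),\mathrm{FirstNonMin}(\alpha),\mathrm{SecondLastNonMax}(\alpha)\rangle$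 that belongs to $\mathbf{A}_k(n)$ (this is always well defined). *)

(* Defs.v *)
From mathcomp Require Import all_boot.
Set Implicit Arguments. Unset Strict Implicit. Unset Printing Implicit Defensive.

(* Strings over Sigma = {0,...,k-1} are represented as  s : seq nat
   with  all (fun x => x < k) s.  Positions in the paper are 1-based;
   here they are 0-based (paper position p  <->  index p-1). *)

Fixpoint lexle (s t : seq nat) : bool :=
  match s, t with
  | [::], _ => true
  | _ :: _, [::] => false
  | x :: s', y :: t' => (x < y) || ((x == y) && lexle s' t')
  end.

Definition rotations (s : seq nat) : seq (seq nat) :=
  [seq rot i s | i <- iota 0 (size s)].

Definition necklace (s : seq nat) : bool :=
  all (fun t => lexle s t) (rotations s).

Definition bracelet (s : seq nat) : bool :=
  all (fun t => lexle s t) (rotations s ++ rotations (rev s)).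

Definition symmetric (s : seq nat) : bool := rev s \in rotations s.

Definition inA (k n : nat) (s : seq nat) : bool :=
  [&& size s == n, all (fun x => x < k) s, bracelet s & ~~ symmetric s].

Definition rnk (n k : nat) : seq nat := nseq (n - 2) 0 ++ [:: k - 2; k - 1].

Definition neck (s : seq nat) : seq nat :=
  foldl (fun m t => if lexle t m then t else m) s (rotations s).

Definition nonMaxIdx (k : nat) (s : seq nat) : seq nat :=
  [seq i <- iota 0 (size s) | nth 0 s i != k.-1].

Definition lastNonMaxIdx (k : nat) (s : seq nat) : option nat :=
  let l := nonMaxIdx k s in if l is [::] then None else Some (last 0 l).

Definition secondLastNonMaxIdx (k : nat) (s : seq nat) : option nat :=
  let l := nonMaxIdx k s in
  if 2 <= size l then Some (nth 0 l (size l - 2)) else None.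

Definition firstNonMinIdx (s : seq nat) : option nat :=
  let i := find (fun x => x != 0) s in if i < size s then Some i else None.

Definition LastNonMax (k : nat) (s : seq nat) (j : nat) : seq nat :=
  take j s ++ (nth 0 s j).+1 :: nseq (size s - j.+1) k.-1.

Definition LastSymbol (k : nat) (s : seq nat) : seq nat :=
  neck (take (size s).-1 s ++ [:: ((last 0 s).+1) %% k]).

Definition FirstNonMin (s : seq nat) (i : nat) : seq nat :=
  set_nth 0 s i (nth 0 s i).-1.

Definition SecondLastNonMax (s : seq nat) (l : nat) : seq nat :=
  set_nth 0 s l (nth 0 s l).+1.

Definition parCandidates (k : nat) (s : seq nat) : seq (option (seq nat * nat)) :=
  [:: omap (fun j => (LastNonMax k s j, j)) (lastNonMaxIdx k s);
      Some (LastSymbol k s, (size s).-1);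
      omap (fun i => (FirstNonMin s i, i)) (firstNonMinIdx s);
      omap (fun l => (SecondLastNonMax s l, l)) (secondLastNonMaxIdx k s)].

(* Par(alpha) together with p(alpha)-1: the first candidate lying in A_k(n);
   None if no candidate lies in A_k(n) (never happens by the paper). *)
Definition parInfo (k : nat) (s : seq nat) : option (seq nat * nat) :=
  foldr (fun o acc => match o with
                      | Some (b, q) => if inA k (size s) b then Some (b, q) else acc
                      | None => acc
                      end) None (parCandidates k s).

(* s(alpha) = a_{p+1} ... a_n a_1 ... a_{p-1}, with q = p - 1 *)
Definition sfx (s : seq nat) (q : nat) : seq nat := drop q.+1 s ++ take q s.

(* Main.v *)
Require Import Defs.
From mathcomp Require Import all_boot zify.
Set Implicit Arguments. Unset Strict Implicit. Unset Printing Implicit Defensive.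

(** Write m = k - 1, let x be the symbol of alpha that the parent rule changes
    and y its new value.  A shared suffix s and a shared parent force the same y
    (compare digit sums), and alpha is the necklace of x s, so two siblings
    sharing s have x <> x'.  Hence one of them, alpha' = 0^e (y+1) w, uses
    FirstNonMin, and the other either increments x = y - 1 or wraps m to 0.

    Two facts about failing operations decide everything.  If LastNonMax(alpha)
    is not in A then alpha ends with (m-1) m^d, d > 0.  If moreover
    LastSymbol(alpha) is not in A, where alpha = 0^e u m with u starting with a
    nonzero symbol, then e > 0 and rev u <= u.  Applied to alpha', they give
    e > 0, which excludes the wrap because s then ends with 0.  In the increment
    case minimality of both strings forces alpha = 0^e (y-1) w with
    w = m^c (m-1) m^d, and the two facts applied to alpha and alpha' leave no
    room. *)

(** * Strict and weak lexicographic order *)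

Definition lexlt (s t : seq nat) : bool := ~~ lexle t s.

Lemma lexlt_cons x s y t :
  lexlt (x :: s) (y :: t) = (x < y) || ((x == y) && lexlt s t).
Proof. by rewrite /lexlt /=; case: ltngtP. Qed.

Lemma lexlexx s : lexle s s.
Proof. by elim: s => //= x s ->; rewrite eqxx orbT. Qed.

Lemma lexle_total s t : lexle s t || lexle t s.
Proof. by elim: s t => [|x s IHs] [|y t] //=; case: ltngtP => //=. Qed.

Lemma lexle_anti s t : lexle s t -> lexle t s -> s = t.
Proof.
elim: s t => [|x s IHs] [|y t] //=; case: ltngtP => //= -> st ts.
by rewrite (IHs t).
Qed.

Lemma lexle_trans t s u : lexle s t -> lexle t u -> lexle s u.
Proof.
elim: s t u => [|x s IHs] [|y t] [|z u] //= /orP[xy|/andP[/eqP-> st]].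
  by move=> /orP[yz|/andP[/eqP<- _]]; rewrite ?xy // (ltn_trans xy yz).
by move=> /orP[->//|/andP[/eqP-> tu]]; rewrite eqxx (IHs _ _ st tu) orbT.
Qed.

Lemma lexltW s t : lexlt s t -> lexle s t.
Proof. by rewrite /lexlt; case/orP: (lexle_total s t) => ->. Qed.

Lemma lexlt_neqAle s t : lexlt s t = (s != t) && lexle s t.
Proof.
apply/idP/andP => [lt_st|[neq_st le_st]].
  by split; [apply: contraNneq lt_st => ->; apply: lexlexx | exact: lexltW].
by apply: contra neq_st => le_ts; rewrite (lexle_anti le_st le_ts).
Qed.

Lemma lexlt_cat2l p s t : lexlt (p ++ s) (p ++ t) = lexlt s t.
Proof. by elim: p => //= x p IHp; rewrite lexlt_cons ltnn eqxx. Qed.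

Lemma lexlt_nseq a b x z s t : x < z -> b < a ->
  lexlt (nseq a x ++ s) (nseq b x ++ z :: t).
Proof.
move=> xz /subnKC <-; rewrite addSnnS nseqD -catA lexlt_cat2l /=.
by rewrite lexlt_cons xz.
Qed.

(** * Rotations, reversal and membership in A *)

Lemma rotations_allP (P : pred (seq nat)) s : 0 < size s ->
  all P (rotations s) <-> (forall r, P (rot r s)).
Proof.
move=> s_gt0; split=> [/allP Ps r|Ps]; last by apply/allP=> _ /mapP[r _ ->].
have [lt_rs|le_sr] := ltnP r (size s).
  by apply/Ps/map_f; rewrite mem_iota.
rewrite rot_oversize // -(rot0 s); apply/Ps/map_f.
by rewrite mem_iota.
Qed.

Lemma mem_rotations r s : 0 < size s -> rot r s \in rotations s.
Proof.
by move=> s_gt0; apply: (rotations_allP (mem (rotations s)) s_gt0).1; apply/allP.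
Qed.

Lemma rotrE r (s : seq nat) : exists r', rotr r s = rot r' s.
Proof. by exists (size s - r). Qed.

Lemma symmetricP s : 0 < size s ->
  Defs.symmetric s <-> exists r, s = rot r (rev s).
Proof.
move=> s_gt0; split=> [/mapP[r _ Es]|[r Es]].
  have [r' Er'] := rotrE r (rev s); exists r'.
  by rewrite -Er' Es rotK.
have [r' Er'] := rotrE r s.
rewrite /Defs.symmetric (_ : rev s = rot r' s) ?mem_rotations //.
by rewrite -Er' {2}Es rotK.
Qed.

Lemma inAP k n s : 0 < n ->
  inA k n s <-> [/\ size s = n, all (fun x => x < k) s,
                   forall r, lexle s (rot r s) &
                   forall r, lexlt s (rot r (rev s))].
Proof.
move=> n_gt0; split.
  case/and4P=> /eqP sz_s s_lt.
  have s_gt0 : 0 < size s by rewrite sz_s.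
  have rs_gt0 : 0 < size (rev s) by rewrite size_rev.
  rewrite /bracelet all_cat => /andP[/(rotations_allP _ s_gt0) le1].
  move=> /(rotations_allP _ rs_gt0) le2 asym; split=> // r.
  rewrite lexlt_neqAle le2 andbT; apply: contra asym => /eqP Es.
  by apply/symmetricP => //; exists r.
case=> sz_s s_lt le1 lt2.
have s_gt0 : 0 < size s by rewrite sz_s.
have rs_gt0 : 0 < size (rev s) by rewrite size_rev.
rewrite /inA sz_s eqxx s_lt /bracelet all_cat /=; apply/andP; split.
  apply/andP; split; apply/rotations_allP => // r.
  exact/lexltW/lt2.
apply/negP=> /(symmetricP s_gt0)[r Es].
by have := lt2 r; rewrite -Es /lexlt lexlexx.
Qed.

(** * Incrementing the last non-maximal symbol *)

Lemma rot_cat_cons r (v w : seq nat) :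
  exists v' w', forall x, rot r (v ++ x :: w) = v' ++ x :: w'.
Proof.
have [le_rv|lt_vr] := leqP r (size v).
  exists (drop r v), (w ++ take r v) => x; rewrite /rot drop_cat take_cat.
  case: ltngtP le_rv => // [_ _|-> _]; first by rewrite -catA.
  by rewrite subnn drop0 take0 drop_size take_size cats0.
exists (drop (r - (size v).+1) w ++ v), (take (r - (size v).+1) w) => x.
rewrite /rot drop_cat take_cat ltnNge (ltnW lt_vr) /=.
by rewrite -[r - size v]prednK ?subn_gt0 // -subnS /= -!catA.
Qed.

(** If the strings tie up to the place of [u], the left symbol there is at most u, hence below u+1.
    What follows [v] is never reached, so [s'] is arbitrary. *)
Lemma lexlt_bump_before u v v' s s' w :
  size v' < size v -> lexle (v ++ s) (v' ++ u :: w) ->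
  lexlt (v ++ s') (v' ++ u.+1 :: w).
Proof.
elim: v' v => [|z v' IHv] [|y v] //= sz_v; rewrite lexlt_cons.
  by rewrite ltnS => /orP[/ltnW->//|/andP[/eqP-> _]]; rewrite leqnn.
by move=> /orP[->//|/andP[-> /IHv->]]; rewrite ?orbT.
Qed.

Lemma lexlt_bump_at u v v' w w' :
  size v' = size v -> lexlt (v ++ u :: w) (v' ++ u :: w') ->
  lexlt (v ++ u.+1 :: w) (v' ++ u.+1 :: w').
Proof.
elim: v' v => [|z v' IHv] [|y v] //=.
by move=> [sz_v]; rewrite !lexlt_cons => /orP[->//|/andP[-> /IHv->]]; rewrite ?orbT.
Qed.

Lemma lexle_nseq_max m d t :
  all (fun x => x <= m) t -> size t <= d -> lexle t (nseq d m).
Proof.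
elim: t d => [|x t IHt] [|d] //= /andP[]; rewrite leq_eqVlt.
by case/orP=> [/eqP-> /IHt le_t /le_t ->|->//]; rewrite eqxx orbT.
Qed.

(** Only an opposing symbol u or u+1 at the place of the left [u] could reverse the comparison. For
    u+1, the permutation would put u+1 on the left, where only u and m's remain. For u, the rest m^d
    is already maximal for its length, against strictness. *)
Lemma lexlt_bump_after m d u v v' w :
  u.+1 \notin nseq d m -> size v < size v' ->
  all (fun x => x <= m) (v' ++ u :: w) ->
  perm_eq (v ++ u :: nseq d m) (v' ++ u :: w) ->
  lexlt (v ++ u :: nseq d m) (v' ++ u :: w) ->
  lexlt (v ++ u.+1 :: nseq d m) (v' ++ u.+1 :: w).
Proof.
move=> notin; elim: v v' => [|y v IHv] [|z v'] //= sz_v /andP[_ le_m] eq_p;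
  rewrite !lexlt_cons; last first.
  move=> /orP[->//|/andP[/eqP Ey lt_v]]; move: eq_p; rewrite Ey perm_cons.
  by move=> eq_p; rewrite eqxx IHv ?orbT.
move=> /orP[|/andP[/eqP Ey]].
  rewrite leq_eqVlt => /orP[/eqP Ez|->//].
  have := perm_mem eq_p z; rewrite !inE eqxx /= -Ez (negPf notin) orbF.
  by rewrite gtn_eqF.
move: eq_p; rewrite -Ey perm_cons => /perm_size; rewrite size_nseq => sz_d.
by rewrite /lexlt lexle_nseq_max // -sz_d.
Qed.

(* Incrementing the last non-maximal symbol preserves all comparisons with
   rotations, and breaks one with a reversed rotation t only if t has u.+1 in
   the place of u; as t is a permutation of the string, u.+1 is then the
   maximal symbol. *)
Lemma inA_bump_last m n v u d :
  u < m -> u.+1 \notin nseq d m ->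
  inA m.+1 n (v ++ u :: nseq d m) -> inA m.+1 n (v ++ u.+1 :: nseq d m).
Proof.
move=> lt_um notin As.
have n_gt0 : 0 < n by case/and4P: As => /eqP<- _ _ _; rewrite size_cat addnS.
have/(inAP _ _ n_gt0)[sz_s lt_s le1 lt2] := As; apply/(inAP _ _ n_gt0).
(* Otherwise the string is u m^d, whose reverse m^d u is one of its rotations. *)
have v_gt0 : 0 < size v.
  case: v {As sz_s lt_s le1} lt2 => // /(_ d) /=.
  by rewrite rev_cons rev_nseq -cats1 -{2}(size_nseq d m) rot_size_cat /lexlt lexlexx.
have head_v : head 0 v <= u.
  move: (le1 (size v)) v_gt0; rewrite rot_size_cat; case: (v) => //= y v'.
  by move=> /orP[/ltnW|/andP[/eqP-> _]].
split.
- by rewrite -sz_s !size_cat.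
- by move: lt_s; rewrite !all_cat /= => /and3P[-> _ ->]; rewrite !ltnS lt_um.
- move=> r; have [le_rv|lt_vr] := leqP r (size v).
    have [->|r_gt0] := posnP r; first by rewrite rot0 lexlexx.
    apply: lexltW; move: (le1 r); have rotE x : rot r (v ++ x :: nseq d m) =
        drop r v ++ x :: nseq d m ++ take r v.
      rewrite /rot drop_cat take_cat; case: ltngtP le_rv => // [_ _|-> _].
        by rewrite -catA.
      by rewrite subnn drop0 take0 drop_size take_size cats0.
    rewrite !rotE; apply: lexlt_bump_before.
    by rewrite size_drop ltn_subrL r_gt0.
  have [le_sr|lt_rs] := leqP (size (v ++ u.+1 :: nseq d m)) r.
    by rewrite rot_oversize // lexlexx.
  (* This rotation starts inside the final block, hence with m, while the string starts with a
     symbol at most u < m. *)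
  rewrite /rot drop_cat ltnNge (ltnW lt_vr) /=.
  rewrite -[r - size v]prednK ?subn_gt0 // -subnS /= drop_nseq.
  have: 0 < d - (r - (size v).+1).
    by move: lt_rs; rewrite size_cat /= size_nseq; lia.
  case: (d - _) => //= d' _; case: (v) v_gt0 head_v => //= y v' _ le_yu.
  by rewrite (leq_ltn_trans le_yu lt_um).
move=> r; move: (lt2 r); rewrite !rev_cat !rev_cons -!cats1 -!catA /=.
have [v' [w' rotE]] := rot_cat_cons r (rev (nseq d m)) (rev v).
have p_s : perm_eq (v ++ u :: nseq d m) (v' ++ u :: w').
  by rewrite -rotE perm_sym perm_rot -cat_rcons -rev_cons -rev_cat perm_rev.
rewrite !rotE; case: (ltngtP (size v') (size v)) => sz_v lt_s'.
- exact: lexlt_bump_before (lexltW lt_s').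
- by apply: lexlt_bump_after lt_s' => //; rewrite -(perm_all _ p_s).
- exact: lexlt_bump_at.
Qed.

(** * Strings with a unique longest run of zeros *)

Lemma lexlt_nseq0 a t s y :
  has (predC1 0) (take a t) -> lexlt (nseq a 0 ++ s) (t ++ y).
Proof.
elim: a t => [|a IHa] [|x t] //=; rewrite lexlt_cons.
by case: x => //= /IHa ->.
Qed.

(** A window of [rev w] is the reverse of a full window of [w] or, when truncated at the end, of a
    prefix of [w], which contains the nonzero head. *)
Lemma nonzero_window_rev a w : 0 < a -> head 0 w != 0 ->
  (forall r, r < size w -> has (predC1 0) (take a (drop r w))) ->
  forall r, r < size w -> has (predC1 0) (take a (drop r (rev w))).
Proof.
move=> a_gt0 hw win r lt_rw; rewrite drop_rev take_rev has_rev size_take_min.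
set c := size w - r; have c_gt0 : 0 < c by rewrite subn_gt0.
have le_cw : c <= size w by apply: leq_subr.
rewrite (minn_idPl le_cw); have [le_ac|lt_ca] := leqP a c.
  have -> : drop (c - a) (take c w) = take a (drop (c - a) w).
    by rewrite take_drop subnKC.
  by apply: win; lia.
rewrite (eqP (ltnW lt_ca : c - a == 0)) drop0.
by case: (w) hw c_gt0 => //= x w' hx; case: (c) => //= c' _; rewrite hx.
Qed.

(** Among the rotations of the string and of its reverse, only 0^a w and 0^a (rev w) start with a
    zeros, so the comparison of [w] with [rev w] decides membership. *)
Lemma inA_unique_zero_run k n a w :
  0 < a -> a + size w = n -> all (fun x => x < k) w -> 0 < k ->
  head 0 w != 0 -> last 0 w != 0 ->
  (forall r, r < size w -> has (predC1 0) (take a (drop r w))) ->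
  lexlt w (rev w) -> inA k n (nseq a 0 ++ w).
Proof.
move=> a_gt0 sz_n lt_w k_gt0 hw lw win w_lt.
have n_gt0 : 0 < n by rewrite -sz_n addn_gt0 a_gt0.
have hrw : head 0 (rev w) != 0.
  by case/lastP: (w) lw => [|w' x] //=; rewrite rev_rcons last_rcons.
have lt_nseq b t y : head 0 t != 0 -> b < a ->
    lexlt (nseq a 0 ++ w) (nseq b 0 ++ t ++ y).
  by case: t => //= z t; rewrite -lt0n => *; apply: lexlt_nseq.
apply/(inAP _ _ n_gt0); split.
- by rewrite size_cat size_nseq.
- by rewrite all_cat lt_w all_nseq k_gt0 orbT.
- move=> r; have [le_ra|lt_ar] := leqP r a.
    have [->|r_gt0] := posnP r; first by rewrite rot0 lexlexx.
    apply: lexltW; rewrite /rot drop_cat size_nseq.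
    case: ltngtP le_ra => // [lt_ra _|-> _].
      by rewrite drop_nseq -catA; apply: lt_nseq => //; rewrite ltn_subrL r_gt0.
    by rewrite subnn drop0; apply: (lt_nseq 0).
  have [le_nr|lt_rn] := leqP n r.
    by rewrite rot_oversize ?lexlexx // size_cat size_nseq sz_n.
  apply: lexltW; rewrite /rot drop_cat size_nseq ltnNge (ltnW lt_ar) /=.
  by apply/lexlt_nseq0/win; lia.
move=> r; rewrite rev_cat rev_nseq.
have lt0 r' : r' < size w -> lexlt (nseq a 0 ++ w) (rot r' (rev w ++ nseq a 0)).
  move=> lt_rw; rewrite /rot drop_cat size_rev lt_rw -catA.
  exact/lexlt_nseq0/nonzero_window_rev.
have [/lt0//|le_wr] := ltnP r (size w).
have [le_nr|lt_rn] := leqP n r.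
  rewrite rot_oversize; last by rewrite size_cat size_rev size_nseq addnC sz_n.
  by rewrite -[X in lexlt _ X]rot0; apply: lt0; case: (w) hw.
rewrite /rot drop_cat take_cat size_rev ltnNge le_wr /= drop_nseq.
have [Er|lt_wr] := eqVneq r (size w).
  by rewrite Er subnn take0 cats0 subn0 lexlt_cat2l.
by apply: lt_nseq => //; lia.
Qed.

(** * Smallest rotations and failure of [LastSymbol] *)

Lemma foldl_lexmin_spec m l :
  let x := foldl (fun m t => if lexle t m then t else m) m l in
  (x \in m :: l) && all (lexle x) (m :: l).
Proof.
elim: l m => [|t l IHl] m /=; first by rewrite inE eqxx lexlexx.
move: (IHl (if lexle t m then t else m)) => /=; set x := foldl _ _ _.
rewrite !inE => /and3P[x_in le_x ->]; rewrite andbT.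
case: ifP x_in le_x => [le_tm|/negbT lt_mt] /orP[/eqP->|->] le_x.
- by rewrite eqxx orbT le_tm lexlexx.
- by rewrite !orbT le_x (lexle_trans le_x le_tm).
- by rewrite eqxx lexlexx (lexltW lt_mt).
- by rewrite !orbT le_x (lexle_trans le_x (lexltW lt_mt)).
Qed.

Lemma neck_rot s : exists r, neck s = rot r s.
Proof.
have /andP[] := foldl_lexmin_spec s (rotations s); rewrite -/(neck s) inE.
by case/orP=> [/eqP->|/mapP[r _ ->]] _; [exists 0; rewrite rot0 | exists r].
Qed.

Lemma neck_eq r s t : 0 < size s -> t = rot r s ->
  (forall r', lexle t (rot r' t)) -> neck s = t.
Proof.
move=> s_gt0 Et le_t; have [r1 Er1] := neck_rot s.
have /andP[_ /= /andP[_ le_n]] := foldl_lexmin_spec s (rotations s).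
apply: lexle_anti; first by rewrite Et; apply: (rotations_allP _ s_gt0).1 le_n _.
have [r2 Er2] := rotrE r t; have Es : s = rot r2 t by rewrite -Er2 Et rotK.
by rewrite Er1 Es rot_rot_add.
Qed.

Lemma lexlt_rcons2 s t x :
  size s = size t -> lexlt (rcons s x) (rcons t x) = lexlt s t.
Proof.
elim: s t => [|y s IHs] [|z t] //=; first by rewrite lexlt_cons ltnn eqxx.
by move=> [sz_s]; rewrite !lexlt_cons IHs.
Qed.

Lemma size_inA k n s : inA k n s -> size s = n.
Proof. by case/and4P=> /eqP. Qed.

Lemma LastSymbol_rcons_max m s : LastSymbol m.+1 (rcons s m) = neck (rcons s 0).
Proof.
by rewrite /LastSymbol size_rcons /= last_rcons modnn -cats1 take_size_cat // cats1.
Qed.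

Lemma inA_LastSymbol m n e w :
  head 0 w != 0 -> last 0 w != 0 -> lexlt w (rev w) ->
  inA m.+1 n (nseq e 0 ++ rcons w m) ->
  inA m.+1 n (LastSymbol m.+1 (nseq e 0 ++ rcons w m)).
Proof.
move=> hw lw lt_w As.
have sz_n := size_inA As; rewrite size_cat size_rcons size_nseq in sz_n.
have n_gt0 : 0 < n by rewrite -sz_n addnS.
have/(inAP _ _ n_gt0)[_ lt_s le1 _] := As.
have At : inA m.+1 n (nseq e.+1 0 ++ w).
  apply: inA_unique_zero_run => //; first by rewrite -sz_n addSnnS.
    by move: lt_s; rewrite all_cat all_rcons => /and3P[].
  move=> r lt_rw; apply/contraT=> /hasPn no_nz.
  have: all (pred1 0) (take e.+1 (drop r w)).
    by apply/allP=> x /no_nz /= /negPn.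
  move/all_pred1P; rewrite size_take_min size_drop => zeros.
  have [lt_e|le_e] := leqP e.+1 (size w - r).
    have := le1 (e + r); rewrite /rot drop_cat size_nseq ltnNge leq_addr addKn /=.
    rewrite -cats1 drop_cat lt_rw -(cat_take_drop e.+1 (drop r w)) zeros.
    rewrite (minn_idPl lt_e).
    case: (w) hw => // z w'; rewrite /= -lt0n => z_gt0.
    apply: contraTT => _; rewrite -[~~ _]/(lexlt _ _) -!catA.
    exact: (@lexlt_nseq e.+1 e).
  (* Here the window reaches the end of [w], whose last symbol is nonzero. *)
  rewrite take_oversize ?size_drop ?(ltnW le_e) // in zeros.
  move: lw; rewrite -(cat_take_drop r w) zeros last_cat.
  have: 0 < minn e.+1 (size w - r) by rewrite leq_min subn_gt0.
  by case: (minn _ _) => // d _; rewrite -[d.+1]addn1 nseqD last_cat.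
rewrite -rcons_cat LastSymbol_rcons_max.
rewrite (@neck_eq (n.-1) _ (nseq e.+1 0 ++ w)) //; first by rewrite size_rcons.
  rewrite -cats1 (_ : n.-1 = size (nseq e 0 ++ w)) ?rot_size_cat //.
  by rewrite size_cat size_nseq -sz_n addnS.
by have/(inAP _ _ n_gt0)[] := At.
Qed.

(** For e = 0, the reverse m (rev w) rotates to (rev w) m, which must exceed w m; this contradicts
    rev w <= w. *)
Lemma LastSymbol_notinA m n e w :
  head 0 w != 0 -> last 0 w != 0 ->
  inA m.+1 n (nseq e 0 ++ rcons w m) ->
  ~~ inA m.+1 n (LastSymbol m.+1 (nseq e 0 ++ rcons w m)) ->
  0 < e /\ lexle (rev w) w.
Proof.
move=> hw lw As notA.
have le_w : lexle (rev w) w.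
  by apply: contraNT notA => lt_w; apply: inA_LastSymbol.
split=> //; case: e As {notA} => //= As.
have n_gt0 : 0 < n by rewrite -(size_inA As) size_rcons.
have/(inAP _ _ n_gt0)[_ _ _ /(_ 1)] := As.
by rewrite rev_rcons rot1_cons lexlt_rcons2 ?size_rev // /lexlt le_w.
Qed.

(** * Comparing and choosing decompositions of a string *)

Lemma eq_cat_cons (T : Type) (s t s' t' : seq T) x x' :
  s ++ x :: t = s' ++ x' :: t' ->
  [\/ [/\ s = s', x = x' & t = t'],
      exists r, s' = s ++ x :: r /\ t = r ++ x' :: t' |
      exists r, s = s' ++ x' :: r /\ t' = r ++ x :: t].
Proof.
elim: s s' => [|y s IHs] [|y' s'] /= [].
- by move=> -> ->; constructor 1.
- by move=> -> ->; constructor 2; exists s'.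
- by move=> <- <-; constructor 3; exists s.
move=> <- /IHs[[-> -> ->]|[r [-> ->]]|[r [-> ->]]].
- by constructor 1.
- by constructor 2; exists r.
- by constructor 3; exists r.
Qed.

(** The second overlap is written [rcons r x] so that it is nonempty and its last symbol is at
    hand. *)
Lemma eq_catP (T : Type) (s t s' t' : seq T) : s ++ t = s' ++ t' ->
  (exists r, s = s' ++ r /\ t' = r ++ t) \/
  (exists r x, s' = s ++ rcons r x /\ t = rcons r x ++ t').
Proof.
elim: s s' => [|y s IHs] [|y' s'] /=.
- by move=> ->; left; exists [::].
- move=> ->; right; exists (belast y' s'), (last y' s').
  by rewrite -lastI.
- by move=> <-; left; exists (y :: s).
case=> <- /IHs[[r [-> ->]]|[r [x [-> ->]]]]; first by left; exists r.
by right; exists r, x.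
Qed.

Lemma rcons_nseq (T : Type) d (x : T) : rcons (nseq d x) x = nseq d.+1 x.
Proof. by rewrite -cats1 -[d.+1]addn1 nseqD. Qed.

Lemma last_nseq (T : Type) d (x y : T) : last y (nseq d.+1 x) = x.
Proof. by rewrite -rcons_nseq last_rcons. Qed.

Lemma split_last_nonmax m (s : seq nat) :
  s = nseq (size s) m \/ exists v u d, s = v ++ u :: nseq d m /\ u != m.
Proof.
elim/last_ind: s => [|s x IHs]; first by left.
have [->|neq_xm] := eqVneq x m; last first.
  by right; exists s, x, 0; rewrite cats1.
case: IHs => [Es|[v [u [d [-> neq_um]]]]]; [left|right].
  by rewrite size_rcons {1}Es rcons_nseq.
by exists v, u, d.+1; rewrite rcons_cat rcons_cons rcons_nseq.
Qed.

Lemma split_first_nonzero (s : seq nat) :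
  last 0 s != 0 -> exists b z t, s = nseq b 0 ++ z.+1 :: t.
Proof.
elim: s => [|[|x] s IHs] //=; last by exists 0, x, s.
by move=> /IHs[b [z [t ->]]]; exists b.+1, z, t.
Qed.

(** * The indices and operations on explicit decompositions *)

Lemma nonMaxIdx_cat m v u d : u != m ->
  nonMaxIdx m.+1 (v ++ u :: nseq d m) = rcons (nonMaxIdx m.+1 v) (size v).
Proof.
move=> neq_um; rewrite /nonMaxIdx size_cat iotaD filter_cat /= size_nseq.
rewrite nth_cat ltnn subnn /= neq_um -cats1; congr (_ ++ _ :: _).
  by apply: eq_in_filter => i; rewrite mem_iota nth_cat /= => ->.
rewrite (eq_in_filter (a2 := pred0)) ?filter_pred0 // => i.
rewrite mem_iota nth_cat => /andP[lt_vi lt_i]; rewrite ltnNge ltnW //=.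
rewrite -[i - size v]prednK ?subn_gt0 // -subnS /= nth_nseq.
by rewrite (_ : i - _ < d) ?eqxx //; lia.
Qed.

Lemma nonMaxIdx_nseq m d : nonMaxIdx m.+1 (nseq d m) = [::].
Proof.
rewrite /nonMaxIdx (eq_in_filter (a2 := pred0)) ?filter_pred0 // => i.
by rewrite mem_iota size_nseq nth_nseq => /= ->; rewrite eqxx.
Qed.

Lemma firstNonMinIdx_cat e x w : firstNonMinIdx (nseq e 0 ++ x.+1 :: w) = Some e.
Proof.
rewrite /firstNonMinIdx find_cat has_nseq andbF size_nseq /= addn0.
by rewrite size_cat size_nseq /= -addSnnS leq_addr.
Qed.

Lemma secondLastNonMaxIdxP m v u d l : u != m ->
  secondLastNonMaxIdx m.+1 (v ++ u :: nseq d m) = Some l ->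
  exists v' x c, [/\ v = v' ++ x :: nseq c m, x != m & l = size v'].
Proof.
move=> neq_um; rewrite /secondLastNonMaxIdx nonMaxIdx_cat //.
have [->|[v' [x [c [-> neq_xm]]]]] := split_last_nonmax m v.
  by rewrite nonMaxIdx_nseq.
rewrite nonMaxIdx_cat // !size_rcons /= => -[<-]; exists v', x, c; split=> //.
by rewrite -!cats1 -catA nth_cat subSS subn1 /= ltnn subnn.
Qed.

Lemma LastNonMax_cat m v u d :
  LastNonMax m.+1 (v ++ u :: nseq d m) (size v) = v ++ u.+1 :: nseq d m.
Proof.
rewrite /LastNonMax take_size_cat // nth_cat ltnn subnn /=; congr (_ ++ _ :: _).
by congr nseq; rewrite size_cat /= size_nseq; lia.
Qed.

Lemma set_nth_cat (v w : seq nat) x y :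
  set_nth 0 (v ++ x :: w) (size v) y = v ++ y :: w.
Proof. by elim: v => //= z v ->. Qed.

Lemma sfx_cat v x w : sfx (v ++ x :: w) (size v) = w ++ v.
Proof.
by rewrite /sfx take_size_cat // -cat_rcons drop_size_cat // size_rcons.
Qed.

(** * Classification of the parent moves *)

Lemma inA_not_nseq k n d x : 0 < n -> ~~ inA k n (nseq d x).
Proof.
move=> n_gt0; apply/negP=> /(inAP _ _ n_gt0)[_ _ _ /(_ 0)].
by rewrite rev_nseq rot0 /lexlt lexlexx.
Qed.

Lemma bump_last_notinA m n v u d : u < m ->
  inA m.+1 n (v ++ u :: nseq d m) -> ~~ inA m.+1 n (v ++ u.+1 :: nseq d m) ->
  u = m.-1 /\ 0 < d.
Proof.
move=> lt_um As notA.
have: u.+1 \in nseq d m.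
  by apply: contraNT notA => notin; apply: inA_bump_last.
by rewrite mem_nseq => /andP[-> /eqP<-].
Qed.

Lemma sumn_neck s : sumn (neck s) = sumn s.
Proof. by have [r ->] := neck_rot s; apply/perm_sumn; rewrite perm_rot. Qed.

(** Digit sums are invariant under rotation, so this difference recovers the parent's symbol in
    front of the suffix even after [LastSymbol] has rotated the string. *)
Lemma sumn_cat_consB v y w : sumn (v ++ y :: w) - sumn (w ++ v) = y.
Proof. by rewrite !sumn_cat /=; lia. Qed.

(* [s] is the common suffix of the conjugate pair joining [a] to its parent
   and [y] is the symbol that the parent has in front of [s]. *)
Variant par_move m n a s y : Prop :=
| MoveUp v x w of a = v ++ x :: w & s = w ++ v & y = x.+1 & 0 \notin w
    & m.-1 \in w -> exists c d, w = nseq c m ++ m.-1 :: nseq d.+1 m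
                    /\ ~~ inA m.+1 n (LastSymbol m.+1 a)
| MoveWrap of a = rcons s m & y = 0 & last 0 s != 0
| MoveDown e w v d of a = nseq e 0 ++ y.+1 :: w & s = w ++ nseq e 0
    & a = v ++ m.-1 :: nseq d.+1 m & ~~ inA m.+1 n (v ++ m :: nseq d.+1 m)
    & ~~ inA m.+1 n (LastSymbol m.+1 a).

(** [MoveUp] serves both [LastNonMax], where w = m^d makes the last condition vacuous, and
    [SecondLastNonMax], where that condition records the failure of [LastSymbol]. *)
Lemma parInfoP m n a b q : 1 < m -> 0 < n -> inA m.+1 n a ->
  parInfo m.+1 a = Some (b, q) ->
  par_move m n a (sfx a q) (sumn b - sumn (sfx a q)).
Proof.
move=> m_gt1 n_gt0 Aa; have sz_a := size_inA Aa.
have [Ea|[v [u [d [Ea neq_um]]]]] := split_last_nonmax m a.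
  by rewrite Ea (negPf (inA_not_nseq _ _ _ _)) in Aa.
have lt_um : u < m.
  have/(inAP _ _ n_gt0)[_ + _ _] := Aa; rewrite Ea all_cat /= => /and3P[_ + _].
  by rewrite ltnS leq_eqVlt (negPf neq_um).
have NE := nonMaxIdx_cat v d neq_um; rewrite -Ea in NE.
have lastE : lastNonMaxIdx m.+1 a = Some (size v).
  by rewrite /lastNonMaxIdx NE last_rcons; case: (nonMaxIdx _ _).
have LE : LastNonMax m.+1 a (size v) = v ++ u.+1 :: nseq d m.
  by rewrite Ea LastNonMax_cat.
rewrite /parInfo /parCandidates /= lastE /= LE sz_a; case: ifP => [_ [<- <-]|/negbT notL].
  rewrite {2 3}Ea sfx_cat sumn_cat_consB.
  apply: (MoveUp Ea) => //; rewrite mem_nseq; first by lia.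
  by case/andP=> _ /eqP; lia.
have [Eu d_gt0] : u = m.-1 /\ 0 < d by apply: bump_last_notinA notL; rewrite // -Ea.
case: d d_gt0 Ea LE NE notL => // d _ Ea LE NE notL.
have m_gt0 := ltnW m_gt1; rewrite Eu ?(prednK m_gt0) in Ea NE notL.
case: ifP => [_ [<- <-]|/negbT notS].
  have Ea' : a = rcons (v ++ m.-1 :: nseq d m) m.
    by rewrite Ea rcons_cat rcons_cons rcons_nseq.
  have -> : sfx a n.-1 = v ++ m.-1 :: nseq d m.
    by rewrite Ea' -cats1 -sz_a Ea' size_rcons sfx_cat.
  have -> : sumn (LastSymbol m.+1 a) = sumn (v ++ m.-1 :: nseq d m).
    by rewrite Ea' LastSymbol_rcons_max sumn_neck sumn_rcons addn0.
  rewrite subnn; apply: MoveWrap => //.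
  (* The suffix ends with m or, for d = 0, with m-1, which is positive as m > 1. *)
  by rewrite last_cat /= -lt0n; case: (d) => [|d']; rewrite ?last_nseq //=; lia.
have second l : secondLastNonMaxIdx m.+1 a = Some l ->
    Some (SecondLastNonMax a l, l) = Some (b, q) ->
    par_move m n a (sfx a q) (sumn b - sumn (sfx a q)).
  have neq_m : m.-1 != m by rewrite neq_ltn prednK // leqnn.
  rewrite {1}Ea => /(secondLastNonMaxIdxP neq_m)[v' [x [c [Ev neq_xm ->]]]] [<- <-].
  have Ea' : a = v' ++ x :: nseq c m ++ m.-1 :: nseq d.+1 m.
    by rewrite Ea Ev -catA.
  rewrite /SecondLastNonMax {2 3 4 5}Ea' nth_cat ltnn subnn set_nth_cat sfx_cat.
  rewrite sumn_cat_consB; apply: (MoveUp Ea') => // [|_]; last by exists c, d.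
  by rewrite mem_cat !(inE, mem_nseq); lia.
have last_a : last 0 a != 0 by rewrite Ea last_cat last_cons last_nseq -lt0n.
have [e [x [w Ea']]] := split_first_nonzero last_a.
have -> : firstNonMinIdx a = Some e by rewrite Ea' firstNonMinIdx_cat.
rewrite /=; case: ifP => [_ [<- <-]|_].
  have -> : FirstNonMin a e = nseq e 0 ++ x :: w.
    have := set_nth_cat (nseq e 0) w x.+1 x; rewrite size_nseq => <-.
    by rewrite Ea' /FirstNonMin nth_cat size_nseq ltnn subnn.
  have -> : sfx a e = w ++ nseq e 0.
    by have := sfx_cat (nseq e 0) x.+1 w; rewrite -Ea' size_nseq.
  by rewrite sumn_cat_consB; apply: (MoveDown Ea') Ea notL notS.
by case E2: (secondLastNonMaxIdx _ a) => [l|] //=; case: ifP => // _; apply: second.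
Qed.

(** * Constraints on siblings with a common suffix *)

Lemma lexle_rev_nseq m c d y : y < m ->
  lexle (rev (nseq c m ++ y :: nseq d m)) (nseq c m ++ y :: nseq d m) -> d <= c.
Proof.
move=> lt_ym; rewrite rev_cat rev_cons !rev_nseq -cats1 -catA /= leqNgt.
apply: contraL => lt_cd; rewrite -[~~ _]/(lexlt _ _).
rewrite -(subnKC lt_cd) addSnnS nseqD -catA lexlt_cat2l /= lexlt_cons.
by rewrite lt_ym.
Qed.

(** If the first nonzero symbol were also the last one different from m, the string would be 0^e
    (m-1) m^(d+1); failure of [LastSymbol] then forces d = 0, which is the excluded root. *)
Lemma MoveDown_shape m n e y w v d :
  1 < m -> inA m.+1 n (nseq e 0 ++ y.+1 :: w) ->
  nseq e 0 ++ y.+1 :: w != rnk n m.+1 ->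
  nseq e 0 ++ y.+1 :: w = v ++ m.-1 :: nseq d.+1 m ->
  ~~ inA m.+1 n (LastSymbol m.+1 (nseq e 0 ++ y.+1 :: w)) ->
  0 < e /\ exists w', w = w' ++ m.-1 :: nseq d.+1 m /\
                      v = nseq e 0 ++ y.+1 :: w'.
Proof.
move=> m_gt1 Aa neq_r Ea notS.
have lastN z : last z (m.-1 :: nseq d m) != 0.
  by case: (d) => [|d']; rewrite last_cons ?last_nseq /=; lia.
have [[_ Ey Ew]|[r [Ev Ew]]|[r [Ee _]]] := eq_cat_cons Ea; last first.
- have: m.-1 \in nseq e 0 by rewrite Ee mem_cat inE eqxx orbT.
  by rewrite mem_nseq; lia.
- split; last by exists r.
  have Ew' : y.+1 :: w = rcons (y.+1 :: r ++ m.-1 :: nseq d m) m.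
    by rewrite Ew rcons_cons rcons_cat rcons_cons rcons_nseq.
  rewrite Ew' in Aa notS; have [] // := LastSymbol_notinA _ _ Aa notS.
  by rewrite last_cons last_cat; apply: lastN.
have Ew' : y.+1 :: w = rcons (m.-1 :: nseq d m) m.
  by rewrite Ew Ey rcons_cons rcons_nseq.
rewrite Ew' in Aa notS neq_r.
have [] // := LastSymbol_notinA _ (lastN 0) Aa notS; first by rewrite /=; lia.
move=> _ /(@lexle_rev_nseq m 0 d m.-1); rewrite prednK ?(ltnW m_gt1) //.
move/(_ (leqnn _)); rewrite leqn0 => /eqP d0; case/eqP: neq_r.
have := size_inA Aa; rewrite d0 /rnk size_cat size_nseq /= addn2 => <-.
by rewrite !subSS !subn0 subn1.
Qed.

(** Write r = 0^b (z+1) t. Rotating the first string by [size r] rules out b < e; bringing [r] to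
    the front of the second rules out b > e. For b = e they give z+1 <= x and x+2 <= z+1. *)
Lemma necklace_shift_false e x w r : last 0 r != 0 ->
  (forall i, lexle ((r ++ nseq e 0) ++ x :: w) (rot i ((r ++ nseq e 0) ++ x :: w))) ->
  (forall i, lexle (nseq e 0 ++ x.+2 :: w ++ r) (rot i (nseq e 0 ++ x.+2 :: w ++ r))) ->
  False.
Proof.
move=> /split_first_nonzero[b [z [t Er]]] /(_ (size r)) +
  /(_ (size (nseq e 0 ++ x.+2 :: w))).
have -> : nseq e 0 ++ x.+2 :: w ++ r = (nseq e 0 ++ x.+2 :: w) ++ r by rewrite -catA.
rewrite -[(r ++ _) ++ _]catA !rot_size_cat Er -!catA /=.
case: (ltngtP b e) => [lt_be|lt_eb|->].
- by rewrite (negPf (lexlt_nseq _ _ _ lt_be)).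
- by move=> _; rewrite (negPf (lexlt_nseq _ _ _ lt_eb)).
have le_cat p s1 s2 : lexle (p ++ s1) (p ++ s2) = lexle s1 s2.
  by rewrite -[LHS]negbK -[~~ lexle _ _]/(lexlt _ _) lexlt_cat2l negbK.
by rewrite !le_cat /=; lia.
Qed.

(** Both strings are rotations of x followed by the common suffix, and a rotation class has one
    smallest element. *)
Lemma necklace_unique x v w v' w' :
  (forall i, lexle (v ++ x :: w) (rot i (v ++ x :: w))) ->
  (forall i, lexle (v' ++ x :: w') (rot i (v' ++ x :: w'))) ->
  w ++ v = w' ++ v' -> v ++ x :: w = v' ++ x :: w'.
Proof.
set a := v ++ _; set a' := v' ++ _ => le_a le_a' E.
have Er : rot (size v) a = rot (size v') a' by rewrite !rot_size_cat /= E.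
apply: lexle_anti.
  by rewrite -(rotK (size v') a') -Er /rotr rot_rot_add.
by rewrite -(rotK (size v) a) Er /rotr rot_rot_add.
Qed.

Lemma inA_zeros_max m n e y c : 0 < e -> 0 < y < m ->
  e + c.+2 = n -> inA m.+1 n (nseq e 0 ++ y :: nseq c.+1 m).
Proof.
move=> e_gt0 /andP[y_gt0 lt_ym] sz_n.
have no0 : 0 \notin y :: nseq c.+1 m by rewrite inE mem_nseq; lia.
apply: inA_unique_zero_run => //.
- by rewrite /= size_nseq.
- by rewrite /= all_nseq !ltnS leqnn orbT andbT ltnW.
- by rewrite /= -lt0n.
- by rewrite last_cons last_nseq; lia.
- move=> r lt_r; case Dt: (drop r _) => [|z t].
    by move: lt_r; rewrite -subn_gt0 -size_drop Dt.
  have: z \in y :: nseq c.+1 m by apply: (@mem_drop r); rewrite Dt mem_head.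
  case: (e) e_gt0 => //= e' _ z_in; apply/orP; left.
  by apply: contraNneq no0 => <-.
by rewrite rev_cons rev_nseq /= lexlt_cons lt_ym.
Qed.

Lemma MoveUp_MoveDown_false m n e x c d (w := nseq c m ++ m.-1 :: nseq d.+1 m) :
  1 < m -> 0 < n -> 0 < e ->
  inA m.+1 n (nseq e 0 ++ x :: w) -> inA m.+1 n (nseq e 0 ++ x.+2 :: w) ->
  ~~ inA m.+1 n (LastSymbol m.+1 (nseq e 0 ++ x :: w)) ->
  ~~ inA m.+1 n (LastSymbol m.+1 (nseq e 0 ++ x.+2 :: w)) ->
  ~~ inA m.+1 n ((nseq e 0 ++ x.+2 :: nseq c m) ++ m :: nseq d.+1 m) ->
  False.
Proof.
move=> m_gt1 n_gt0 e_gt0 Aa Aa' notS notS' notL'.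
have/(inAP _ _ n_gt0)[_ + _ lt2] := Aa'.
rewrite all_cat /= ltnS => /and3P[_ le_xm _].
have lastN z t : last z (t ++ m.-1 :: nseq d m) != 0.
  by rewrite last_cat; case: (d) => [|d']; rewrite last_cons ?last_nseq /=; lia.
have wE : w = rcons (nseq c m ++ m.-1 :: nseq d m) m.
  by rewrite rcons_cat rcons_cons rcons_nseq.
(* The reverse starts with m-1 if d = 0 and with m otherwise. *)
have le_head y : lexle (rev (y :: nseq c m ++ m.-1 :: nseq d m))
                       (y :: nseq c m ++ m.-1 :: nseq d m) ->
    if d is 0 then m.-1 <= y else m <= y.
  rewrite rev_cons rev_cat rev_cons !rev_nseq; case: (d) => [|d'] /=;
    by move=> /orP[/ltnW|/andP[/eqP-> _]].
(* For x > 0, failure of [LastSymbol] on the first string gives m-1 <= x, but x+2 <= m. *)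
have x0 : x = 0.
  case: x Aa notS le_xm {Aa' notS' notL' lt2} => // x; rewrite wE -rcons_cons.
  move=> Aa notS; have [//||_ /le_head] := LastSymbol_notinA _ _ Aa notS.
    exact: lastN.
  by case: (d); lia.
rewrite {}x0 in Aa Aa' notS notS' notL' le_xm lt2.
have le_dc : d <= c.
  have E0 : nseq e 0 ++ 0 :: w = nseq e.+1 0 ++ w by rewrite -cat_rcons rcons_nseq.
  rewrite E0 wE in Aa notS; have [||_] := LastSymbol_notinA _ _ Aa notS.
  - by case: (c) => [|c'] /=; lia.
  - exact: lastN.
  by apply: lexle_rev_nseq; lia.
(* For m = 2 the symbol x+2 is itself maximal and joins the block m^c. Comparison with the reverse
   then gives c <= d, so c = d and [2 :: w] is a palindrome. *)
have [m2|m_neq2] := eqVneq m 2.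
  have := lt2 (size (rev (2 :: w))); rewrite rev_cat rev_nseq rot_size_cat lexlt_cat2l.
  have Ew : 2 :: w = nseq c.+1 m ++ m.-1 :: nseq d.+1 m by rewrite -{1}m2.
  have Erw : rev (2 :: w) = nseq d.+1 m ++ m.-1 :: nseq c.+1 m.
    by rewrite Ew rev_cat rev_cons !rev_nseq cat_rcons.
  move=> lt_w; have le_cd : c.+1 <= d.+1.
    apply: (@lexle_rev_nseq m _ _ m.-1); first by lia.
    by rewrite -Erw revK; apply: lexltW.
  have Ecd : c = d by lia.
  by move: lt_w; rewrite Erw Ew Ecd /lexlt lexlexx.
move: notS' Aa'; rewrite wE -rcons_cons => notS' Aa'.
(* With m >= 3, a leading 2 leaves only d = 0 and m = 3. Then [LastNonMax] yields 0^e 2 3^(c+2),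
   which is in A, contrary to its failure. *)
have [//||_ /le_head] := LastSymbol_notinA _ _ Aa' notS'; first exact: lastN.
have sz_n := size_inA Aa'.
case: (d) sz_n notL' => [|d'] sz_n notL' le_m; last by lia.
have m3 : m = 3 by lia.
case/negP: notL'.
have -> : (nseq e 0 ++ 2 :: nseq c m) ++ m :: nseq 1 m = nseq e 0 ++ 2 :: nseq c.+2 m.
  by rewrite -catA -[c.+2]addn2 nseqD.
apply: inA_zeros_max; rewrite ?m3 //; move: sz_n.
by rewrite size_cat /= size_rcons size_cat !size_nseq /= addn1.
Qed.
Lemma MoveUp_MoveDown_disjoint m n a a' s y v x w e w' v' d :
  1 < m -> 0 < n -> inA m.+1 n a -> inA m.+1 n a' -> a' != rnk n m.+1 ->
  a = v ++ x :: w -> s = w ++ v -> y = x.+1 -> 0 \notin w ->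
  (m.-1 \in w -> exists c d, w = nseq c m ++ m.-1 :: nseq d.+1 m
                    /\ ~~ inA m.+1 n (LastSymbol m.+1 a)) ->
  a' = nseq e 0 ++ y.+1 :: w' -> s = w' ++ nseq e 0 ->
  a' = v' ++ m.-1 :: nseq d.+1 m -> ~~ inA m.+1 n (v' ++ m :: nseq d.+1 m) ->
  ~~ inA m.+1 n (LastSymbol m.+1 a') -> False.
Proof.
move=> m_gt1 n_gt0 Aa Aa' neq_r Ea Es Ey w_no0 tail Ea' Es' Ea'' notL' notS'.
subst a' y; have [e_gt0 [t [Ew' Ev']]] := MoveDown_shape m_gt1 Aa' neq_r Ea'' notS'.
have Ew : w ++ v = w' ++ nseq e 0 by rewrite -Es -Es'.
have [[r [Ewr Er]]|[r [z [Ewr Er]]]] := eq_catP Ew; last first.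
  (* [rcons r z] has a nonzero last symbol; minimality of [a] and of [a'] makes
     it start with exactly [e] zeros, followed by a symbol that is at most [x]
     and at least [x.+2]. *)
  have/(inAP _ _ n_gt0)[_ _ le_a _] := Aa; have/(inAP _ _ n_gt0)[_ _ le_a' _] := Aa'.
  rewrite Ea Er in le_a; rewrite Ewr in le_a'; apply: necklace_shift_false le_a le_a'.
  have := congr1 (last 0) Ewr; rewrite Ew' !last_cat last_rcons last_cons last_nseq.
  by rewrite last_rcons => <-; lia.
(* The overlap [r] lies both in 0^e and in the zero-free [w]. *)
have r_nil : r = [::].
  case: r Ewr Er => // z r Ewr Er; case/negP: w_no0.
  have: z \in nseq e 0 by rewrite Er mem_head.
  by rewrite mem_nseq => /andP[_ /eqP<-]; rewrite Ewr mem_cat mem_head orbT.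
rewrite r_nil cats0 in Ewr; rewrite r_nil /= in Er; subst v a.
rewrite -Ewr in Ew' Aa' notS'.
have [|c [d' [Ew2 notS]]] := tail; first by rewrite Ew' mem_cat mem_head orbT.
rewrite Ew2 in Ew' Aa Aa' notS notS'.
have neq_m d0 r0 r1 : nseq d0 m = r0 ++ m.-1 :: r1 -> False.
  move=> E; have: m.-1 \in nseq d0 m by rewrite E mem_cat mem_head orbT.
  by rewrite mem_nseq; lia.
(* Both decompositions of [w] single out its last symbol different from m, so they coincide. *)
have [[Et _ /(congr1 size)]|[r' [_ /neq_m//]]|[r' [_ /neq_m//]]] := eq_cat_cons Ew'.
rewrite !size_nseq => -[Ed]; rewrite Ev' -Et -Ed in notL'.
exact: MoveUp_MoveDown_false Aa Aa' notS notS' notL'.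
Qed.

Theorem mainTheorem10 (n k : nat) :
  3 <= n -> 3 <= k ->
  forall (a a' b : seq nat) (q q' : nat),
    inA k n a -> inA k n a' ->
    a != rnk n k -> a' != rnk n k -> a != a' ->
    parInfo k a = Some (b, q) -> parInfo k a' = Some (b, q') ->
    sfx a q != sfx a' q'.
Proof.
case: k => // m n_ge3 m_gt1 a a' b q q' Aa Aa' neq_ra neq_ra' neq_aa' Pa Pa'.
apply: contra neq_aa' => /eqP Es; apply/eqP.
have n_gt0 : 0 < n by apply: leq_trans n_ge3.
have := parInfoP m_gt1 n_gt0 Aa' Pa'; have := parInfoP m_gt1 n_gt0 Aa Pa.
(* The parent [b] and the suffix are shared, so a single [y] serves both moves. *)
rewrite -Es; move: (sfx a q) (sumn b - _) => s y {Es Pa Pa'} move_a move_a'.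
have/(inAP _ _ n_gt0)[_ _ le_a _] := Aa; have/(inAP _ _ n_gt0)[_ _ le_a' _] := Aa'.
(* A decrement has e > 0, so its suffix ends with 0, unlike that of a wrap. *)
have wrap_down a0 e w v d : inA m.+1 n a0 -> a0 != rnk n m.+1 -> last 0 s != 0 ->
    a0 = nseq e 0 ++ y.+1 :: w -> s = w ++ nseq e 0 ->
    a0 = v ++ m.-1 :: nseq d.+1 m -> ~~ inA m.+1 n (LastSymbol m.+1 a0) -> False.
  move=> + + + Ea0; subst a0 => A0 neq0 + Es0 Ea0 notS.
  have [e_gt0 _] := MoveDown_shape m_gt1 A0 neq0 Ea0 notS.
  by rewrite Es0 last_cat; case: (e) e_gt0 => // e' _; rewrite last_nseq.
case: move_a => [v x w Ea Es Ey w0 tail|Ea Ey s_last|e w v d Ea Es Ea2 notL notS];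
case: move_a' => [v' x' w' Ea' Es' Ey' w0' tail'|Ea' Ey' s_last'
                 |e' w' v' d' Ea' Es' Ea2' notL' notS'].
(* Two moves of the same kind change the same symbol, since [y] determines it. *)
- have Ex : x' = x by lia.
  rewrite Ea' Ex in le_a' *; rewrite Ea in le_a *.
  by apply: necklace_unique => //; rewrite -Es.
- by rewrite Ey' in Ey.
- by case: (@MoveUp_MoveDown_disjoint m n a a' s y v x w e' w' v' d').
- by rewrite Ey in Ey'.
- by rewrite Ea.
- by case: (wrap_down a' e' w' v' d').
- by case: (@MoveUp_MoveDown_disjoint m n a' a s y v' x' w' e w v d).
- by case: (wrap_down a e w v d).
- rewrite Ea' in le_a' *; rewrite Ea in le_a *.
  by apply: necklace_unique => //; rewrite -Es.
Qed.
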